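(* Let $X$ be a compact Kähler manifold of dimension $d$ with $q=\dim V>0$, where $V=H^0(X,\Omega_X^1)$, and let $\psi_2:\bigwedge^2 V\to H^0(X,\Omega_X^2)$ be the wedge-product map. Fix a positive integer $k\le q/2$. If every nonzero element of $\ker\psi_2$ has rank strictly bigger than $2k$, then for a general point $W$ of the Grassmannian $\mathrm{Gr}(2k,V)$ (i.e. for all $W$ in a nonempty Zariski-open subset) the complex of vector spaces $$0\longrightarrow \Sigma^2W\xrightarrow{\ \mu_0\ } W\otimes V\xrightarrow{\ \mu_1\ } H^0(X,\Omega_X^2)$$ is exact, where $\mu_0(w w')=w\otimes w'+w'\otimes w$ and $\mu_1(w\otimes\alpha)=\psi_2(w\wedge\alpha)$.
   Context: $\Sigma^2W$ denotes the second symmetric power of $W$, with product written multiplicatively. An element $v\in\bigwedge^2V$ has rank $2m$ if $v=v_1\wedge v_2+\dots+v_{2m-1}\wedge v_{2m}$ for some linearly independent $v_1,\dots,v_{2m}\in V$ (equivalently, the rank of the associated antisymmetric matrix is $2m$). *)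

(* Defs.v *)
From HB Require Import structures.
From mathcomp Require Import all_boot all_order all_algebra.
From mathcomp Require Import mpoly.
Set Implicit Arguments. Unset Strict Implicit. Unset Printing Implicit Defensive.
Import Order.TTheory GRing.Theory Num.Theory.
Local Open Scope ring_scope.

(* Concrete linear-algebra model.
   V = C^q is 'rV[C]_q.
   V (x) V  is identified with 'M[C]_q via  v (x) w  |->  v^T *m w.
   /\^2 V   is identified with the antisymmetric matrices of 'M[C]_q via
            v /\ w |-> v^T *m w - w^T *m v  (rank of the element = \rank of
            the matrix, as in the paper).
   A subspace W of V of dimension m is the row space of a full-rank
   m x q matrix M.
   W (x) V  = the span of the w (x) a (w in W, a in V)
            = { X : 'M_q | rows of X^T lie in W }.
   Sym^2 W  is identified (char 0) with the symmetric tensors in W (x) W,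
            w w' |-> (w (x) w' + w' (x) w)/2, i.e.
            { S : 'M_q | S^T = S and rows of S lie in W }. *)

Section Model.
Variable C : fieldType.
Variable q : nat.

Definition tens (v w : 'rV[C]_q) : 'M[C]_q := v^T *m w.
Definition wedge (v w : 'rV[C]_q) : 'M[C]_q := v^T *m w - w^T *m v.
Definition antisym (A : 'M[C]_q) : Prop := A^T = - A.

Definition in_WtV m (M : 'M[C]_(m, q)) (X : 'M[C]_q) : Prop := (X^T <= M)%MS.
Definition in_Sym2 m (M : 'M[C]_(m, q)) (S : 'M[C]_q) : Prop :=
  S^T = S /\ (S <= M)%MS.

(* mu0 (w w') = w (x) w' + w' (x) w; with the identification above this is
   S |-> 2 S. *)
Definition mu0 (S : 'M[C]_q) : 'M[C]_q := S *+ 2.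

(* mu1 (w (x) a) = psi2 (w /\ a); in the model w (x) a = X and
   w /\ a = X - X^T, extended linearly. *)
Definition mu1 (U : lmodType C) (psi2 : 'M[C]_q -> U) (X : 'M[C]_q) : U :=
  psi2 (X - X^T).

Definition complex_exact (U : lmodType C) (psi2 : 'M[C]_q -> U)
  m (M : 'M[C]_(m, q)) : Prop :=
  (forall S, in_Sym2 M S -> mu0 S = 0 -> S = 0) /\
  (forall X, in_WtV M X ->
     (mu1 psi2 X = 0 <-> exists2 S, in_Sym2 M S & X = mu0 S)).

End Model.

Definition mx_eval (C : comRingType) m q (P : {mpoly C[m * q]})
  (M : 'M[C]_(m, q)) : C := P.@[fun i => mxvec M 0 i].

(* Main.v *)
Require Import Defs.
From HB Require Import structures.
From mathcomp Require Import all_boot all_order all_algebra.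
From mathcomp Require Import mpoly fraction ring.
From Stdlib Require Import Classical.
Import Order.TTheory GRing.Theory Num.Theory.
Local Open Scope ring_scope.

Set Implicit Arguments. Unset Strict Implicit. Unset Printing Implicit Defensive.

(** Let [K] be the kernel of [psi2] on [/\^2 V] and [Z] the cone of forms of rank
    at most [2k].  Exactness at [W] means that [K] meets [W /\ V] trivially, and
    [W /\ V] is the tangent space of [Z] at a form whose image is [W].  As
    [K] and [Z] meet only at [0], the linear projection along [K] is finite on
    [Z], hence, in characteristic 0, unramified at the general point of [Z].

    Concretely, at the generic point [a = X^T *m J *m X] of [Z], where [X] is a
    matrix of indeterminates, the coordinates of [a] are algebraic over those of
    its projection, so a derivation that kills the projection kills [a].
    Algebraicity is obtained by eliminating one coordinate at a time.  Clearing
    denominators turns this into a polynomial identity that specializes to every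
    [M] outside a hypersurface. *)

(** * Derivations and algebraic elements *)

Section Derivation.
Variables (E : comNzRingType) (D : E -> E).
Hypothesis DD : {morph D : x y / x + y}.
Hypothesis DM : forall x y, D (x * y) = D x * y + x * D y.

Lemma derivation0 : D 0 = 0.
Proof. by apply: (@addrI _ (D 0)); rewrite -DD !addr0. Qed.

Lemma derivation_horner (f : {poly E}) (z : E) :
  (forall i, D f`_i = 0) -> D f.[z] = f^`().[z] * D z.
Proof.
elim/poly_ind: f => [_|p c IH Dp]; first by rewrite deriv0 !horner0 mul0r derivation0.
have Dpi i : D p`_i = 0 by have := Dp i.+1; rewrite coefD coefMX coefC addr0.
have Dc : D c = 0 by have := Dp 0%N; rewrite coefD coefMX coefC add0r.
rewrite derivD derivM derivX derivC !hornerE DD DM IH // Dc; ring.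
Qed.

Lemma derivation_mmap (C : comNzRingType) (i : {rmorphism C -> E}) n
    (y : 'I_n -> E) (F : {mpoly C[n]}) :
  (forall c, D (i c) = 0) -> (forall j, D (y j) = 0) -> D (mmap i y F) = 0.
Proof.
move=> Di Dy.
have DX x k : D x = 0 -> D (x ^+ k) = 0.
  move=> Dx; elim: k => [|k IHk]; first by rewrite expr0 -(rmorph1 i).
  by rewrite exprS DM Dx IHk mul0r mulr0 addr0.
apply: (big_ind (fun x => D x = 0)) => [|a b Da Db|m _].
- exact: derivation0.
- by rewrite DD Da Db addr0.
rewrite DM Di mul0r add0r.
suff -> : D (mmap1 y m) = 0 by rewrite mulr0.
apply: (big_ind (fun x => D x = 0)) => [|a b Da Db|j _]; last exact: DX.
- by rewrite -(rmorph1 i).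
- by rewrite DM Da Db mul0r mulr0 addr0.
Qed.

Lemma map_derivationM m n p (A : 'M[E]_(m, n)) (B : 'M[E]_(n, p)) :
  map_mx D (A *m B) = map_mx D A *m B + A *m map_mx D B.
Proof.
apply/matrixP => i j; rewrite !mxE (big_morph D DD derivation0) -big_split /=.
by apply: eq_bigr => l _; rewrite DM !mxE.
Qed.

End Derivation.

(** Differentiating [f.[z] = 0] gives [f^]().[z] * D z = 0[. Either]D
    z[vanishes or]z[is a root of]f^[()], which is shorter, has coefficients killed by [D], and is
    nonzero in characteristic 0. *)
Lemma derivation_algebraic (E : idomainType) (D : E -> E) (f : {poly E}) (z : E) :
  {morph D : x y / x + y} -> (forall x y, D (x * y) = D x * y + x * D y) ->
  (forall n, n.+1%:R != 0 :> E) -> (forall i, D f`_i = 0) ->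
  f != 0 -> f.[z] = 0 -> D z = 0.
Proof.
move=> DD DM char0; have D0 := derivation0 DD; have [n] := ubnP (size f).
elim: n f => // n IH f lt_fn Df nzf fz.
have /eqP := derivation_horner DD DM z Df; rewrite fz D0 eq_sym mulf_eq0.
case/orP=> [/eqP f'z|/eqP //]; apply: (IH f^`()) => //.
- by rewrite (leq_trans (lt_size_deriv nzf)).
- have DMn x k : D (x *+ k) = D x *+ k.
    by elim: k => [|k IHk]; rewrite ?mulr0n ?D0 // !mulrSr DD IHk.
  by move=> i; rewrite coef_deriv DMn Df mul0rn.
- have gt1f : (1 < size f)%N.
    rewrite ltnNge; apply/negP => /size1_polyC fC.
    by move: nzf (fz); rewrite fC polyC_eq0 hornerC => /eqP.
  apply/eqP => /polyP/(_ (size f).-2); rewrite coef_deriv coef0 -mulr_natr.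
  move=> /eqP; rewrite mulf_eq0 (negPf (char0 _)) orbF.
  have -> : (size f).-2.+1 = (size f).-1 by case: (size f) gt1f => [|[|]].
  by rewrite -lead_coefE lead_coef_eq0 (negPf nzf).
Qed.

(** * Elimination of one variable *)

(* [r] is the norm of [g] from [A[x]/(f)], the determinant of [g] evaluated at
   the companion matrix of [f]. *)
Lemma elimination_norm (A : comNzRingType) (f g : {poly A}) : f \is monic ->
  exists r : A,
    (forall (B : comNzRingType) (phi : {rmorphism A -> B}) (z : B),
       root (map_poly phi f) z -> root (map_poly phi g) z -> phi r = 0) /\
    (forall (B : comNzRingType) (phi : {rmorphism A -> B}),
       map_poly phi g = 1 -> phi r = 1).
Proof.
move=> mon_f; case def_d: (size f) => [|[|d]].
- by move: (monic_neq0 mon_f); rewrite -size_poly_eq0 def_d.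
- exists 1; split=> [B phi z|B phi _]; last exact: rmorph1.
  have -> : f = 1.
    have /size_poly1P[c _ fc] : size f == 1%N by rewrite def_d.
    by move: mon_f; rewrite fc monicE lead_coefC => /eqP ->.
  by rewrite !rmorph1 (negPf (root1 _)).
pose M : 'M[A]_d.+1 :=
  \matrix_(i, j) if i == ord_max then - f`_j else (i.+1 == j)%:R.
exists (\det (horner_mx M g)); split=> [B phi z fz gz|B phi g1]; last first.
  by rewrite -det_map_mx map_horner_mx g1 rmorph1 det1.
rewrite -det_map_mx map_horner_mx.
(* The powers of a root of [f] form an eigenvector of the companion matrix for the eigenvalue [z];
   the matrix evaluated in [g] then scales it by the value of [g] at [z]. *)
pose v : 'cV[B]_d.+1 := \col_i z ^+ i.
have Mv : map_mx phi M *m v = z *: v.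
  apply/colP => i; rewrite !mxE.
  under eq_bigr => j _ do rewrite !mxE.
  case: eqVneq => [->|nei] /=; last first.
    have lt_i : (i.+1 < d.+1)%N.
      rewrite ltn_neqAle ltn_ord andbT; apply: contraNneq nei => e.
      by apply/eqP/val_inj; case: e.
    rewrite (bigD1 (Ordinal lt_i)) //= eqxx rmorph1 mul1r exprS big1 ?addr0 // => j.
    rewrite -val_eqE /= eq_sym => /negPf ->.
    by rewrite rmorph0 mul0r.
  have /eqP := rootP fz; rewrite (@horner_coef_wide _ d.+2); last first.
    by rewrite (leq_trans (size_poly _ _)) // def_d.
  rewrite big_ord_recr /= coef_map /=.
  have -> : f`_d.+1 = 1 by move: mon_f; rewrite monicE lead_coefE def_d => /eqP.
  rewrite rmorph1 mul1r addrC addr_eq0 -exprS => /eqP ->; rewrite -sumrN.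
  by apply: eq_bigr => j _; rewrite coef_map rmorphN mulNr.
have gv (h : {poly B}) : horner_mx (map_mx phi M) h *m v = h.[z] *: v.
  elim/poly_ind: h => [|h c IH]; first by rewrite rmorph0 mul0mx horner0 scale0r.
  rewrite rmorphD rmorphM /= horner_mx_X horner_mx_C mulmxDl !hornerE -mulmxA Mv.
  by rewrite -scalemxAr IH scalerA mul_scalar_mx scalerDl mulrC.
have := gv (map_poly phi g); rewrite (rootP gz) scale0r.
(* The adjugate gives [phi r] times [v] equal to 0, and the first entry of [v] is 1, so no
   cancellation in [B] is required. *)
move=> /(congr1 (mulmx (\adj (horner_mx (map_mx phi M) (map_poly phi g))))).
rewrite mulmxA mul_adj_mx mul_scalar_mx mulmx0 => /colP/(_ 0).
by rewrite !mxE expr0 mulr1.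
Qed.

(** The point is indexed by [nat] so that the same [y] serves after dropping the last variable. *)
Lemma horner_muni (C : comNzRingType) (E : comNzRingType) (i : {rmorphism C -> E})
    n (y : nat -> E) (F : {mpoly C[n.+1]}) :
  mmap i (fun j : 'I_n.+1 => y j) F =
  (map_poly (mmap i (fun j : 'I_n => y j)) (muni F)).[y n].
Proof.
rewrite muniE [in LHS]/mmap rmorph_sum horner_sum /=; apply: eq_bigr => m _.
rewrite map_polyZ /= map_polyXn hornerZ hornerXn mmapZ mmapX -mulrA.
congr (_ * _); rewrite /mmap1 big_ord_recr /=; congr (_ * _).
by apply: eq_bigr => j _; rewrite mnmE.
Qed.

(** * Ideals of cones *)

Section Cone.
Variables (C : closedFieldType) (E : idomainType) (i : {rmorphism C -> E}).
Hypothesis char0 : forall n, n.+1%:R != 0 :> C.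

(* Vanishing at all multiples of [y] makes the ideal homogeneous. *)
Definition cone_ideal n (y : nat -> E) (F : {mpoly C[n]}) :=
  forall a : C, mmap i (fun j : 'I_n => i a * y j) F = 0.

Lemma mmap1_scale n (y : 'I_n -> E) a m :
  mmap1 (fun j => a * y j) m = a ^+ mdeg m * mmap1 y m.
Proof.
rewrite /mmap1 mdegE -prodrXr -big_split /=.
by apply: eq_bigr => j _; rewrite exprMn.
Qed.

(** In characteristic 0 the naturals are pairwise distinct, so there are more roots than the size of
    [Q] allows. *)
Lemma poly_natroots0 (Q : {poly E}) : (forall n : nat, Q.[n%:R] = 0) -> Q = 0.
Proof.
move=> Q0; apply/eqP; apply: contraT => nzQ.
have injn : injective (fun n => n%:R : E).
  suff aux m n : (m <= n)%N -> m%:R = n%:R :> E -> m = n.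
    by move=> m n; case/orP: (leq_total m n) => le /= e; [|apply/esym]; apply: aux.
  move=> le_mn /eqP; rewrite eq_sym -subr_eq0 -natrB // -(rmorph_nat i) fmorph_eq0.
  case: (ltngtP m n) le_mn => // lt_mn _.
  by rewrite -[(n - m)%N]prednK ?subn_gt0 // (negPf (char0 _)).
have := max_poly_roots (rs := [seq n%:R | n <- iota 0 (size Q)]) nzQ.
rewrite size_map size_iota ltnn => -> //; last by rewrite map_inj_uniq ?iota_uniq.
by apply/allP => _ /mapP[n _ ->]; apply/rootP.
Qed.

(** The value of [F] at [b] times [y] is a polynomial [Q] in [b], whose coefficient of degree [d] is
    the value at [y] of the component of degree [d]. It vanishes at all naturals, hence
    identically. *)
Lemma cone_ideal_pihomog n (y : nat -> E) (F : {mpoly C[n]}) d :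
  cone_ideal y F -> cone_ideal y (pihomog mdeg d F).
Proof.
move=> yF a; pose t m := i F@_m * mmap1 (fun j : 'I_n => y j) m.
pose Q := \sum_(m <- msupp F) t m *: 'X^(mdeg m).
have Q0 : Q = 0.
  apply: poly_natroots0 => b; rewrite -(rmorph_nat i b) -(yF b%:R) horner_sum.
  apply: eq_bigr => m _; rewrite hornerZ hornerXn mmap1_scale /t; ring.
have := congr1 (fun P : {poly E} => i a ^+ d * P`_d) Q0.
rewrite coef0 mulr0 coef_sum => <-; rewrite /pihomog rmorph_sum mulr_sumr /=.
rewrite big_mkcond; apply: eq_bigr => m _; rewrite coefZ coefXn eq_sym.
case: eqP => [->|]; rewrite ?mulr0 // mmapZ mmapX mmap1_scale /t /=; ring.
Qed.

Lemma cone_idealB n (y : nat -> E) (F G : {mpoly C[n]}) :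
  cone_ideal y F -> cone_ideal y G -> cone_ideal y (F - G).
Proof. by move=> yF yG a; rewrite rmorphB /= yF yG subrr. Qed.

Lemma cone_idealM n (y : nat -> E) (F G : {mpoly C[n]}) :
  cone_ideal y G -> cone_ideal y (F * G).
Proof. by move=> yG a; rewrite rmorphM /= yG mulr0. Qed.

Lemma mdeg_ord_max n (m : 'X_{1..n.+1}) :
  mdeg m = (mdeg [multinom m (widen_ord (leqnSn n) j) | j < n] + m ord_max)%N.
Proof.
rewrite !mdegE big_ord_recr /=; congr (_ + _)%N.
by apply: eq_bigr => j _; rewrite mnmE.
Qed.

(** Among monomials of degree [d], only the pure power of the last variable has degree [d] in it,
    and its coefficient is the value at the last basis vector. *)
Lemma coef_muni_pihomog n (F : {mpoly C[n.+1]}) d j : (d <= j)%N ->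
  (muni (pihomog mdeg d F))`_j =
  if j == d then
    ((pihomog mdeg d F).@[fun l => (l == ord_max)%:R])%:MP else 0.
Proof.
move=> le_dj; rewrite /pihomog [muni _]raddf_sum /= coef_sum.
have coefE m : mdeg m == d -> (muni (F@_m *: 'X_[m]))`_j =
    if j == d then ((F@_m *: 'X_[m]).@[fun l => (l == ord_max)%:R])%:MP else 0.
  move=> /eqP dm; rewrite muniZ muniE msuppX big_seq1 mcoeffX eqxx scale1r.
  rewrite !coefZ coefXn mevalZ mevalX big_ord_recr /= eqxx expr1n mulr1.
  move: (dm); rewrite mdeg_ord_max; set m' := [multinom _ | _ < _] => dm'.
  rewrite (_ : \prod_(l < n) _ = (m' == 0%MM)%:R); last first.
    case: eqVneq => [m0|m0].
      rewrite big1 // => l _.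
      by have := congr1 (fun u : 'X_{1..n} => u l) m0; rewrite /= mnmE mnm0E => ->.
    have [l ml] : exists l, m' l != 0%N.
      apply/existsP; rewrite -negb_forall; apply: contraNN m0 => /forallP m0.
      by apply/eqP/mnmP => l; rewrite mnm0E; apply/eqP.
    rewrite (bigD1 l) //= -val_eqE /= ltn_eqF // expr0n.
    by move: ml; rewrite mnmE => /negPf ->; rewrite mul0r.
  case: (eqVneq j d) => [jd|ne_jd]; last first.
    rewrite [j == _]gtn_eqF ?mulr0 //.
    rewrite (@leq_ltn_trans d) //; first by rewrite -dm' leq_addl.
    by rewrite ltn_neqAle eq_sym ne_jd.
  rewrite -mdeg_eq0 jd -dm' -[X in _ == X]add0n eqn_add2r.
  case: eqP => [/eqP|_]; last by rewrite !mulr0 mpolyC0.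
  by rewrite mdeg_eq0 => /eqP ->; rewrite !mulr1 mpolyX0 mulr1.
rewrite (eq_bigr _ (fun m => @coefE m)).
case: (j == d); last by rewrite big1.
by rewrite (raddf_sum (meval _)) raddf_sum.
Qed.

(** Some homogeneous component of [F] is nonzero at the last basis vector; that value is its leading
    coefficient in the last variable, so dividing by it suffices. *)
Lemma cone_ideal_monic n (y : nat -> E) (F : {mpoly C[n.+1]}) :
  cone_ideal y F -> F.@[fun j => (j == ord_max)%:R] != 0 ->
  exists2 G : {mpoly C[n.+1]}, cone_ideal y G & muni G \is monic.
Proof.
move=> yF; set e := fun j => _; rewrite {1}(pihomog_partitionE (leqnn (mmeasure mdeg F))).
rewrite raddf_sum /= => nzF.
have [/existsP[d nzFd]|] := boolP [exists d : 'I_(mmeasure mdeg F),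
    (pihomog mdeg d F).@[e] != 0]; last first.
  rewrite negb_exists => /forallP F0; case/negP: nzF; apply/eqP/big1 => d _.
  by apply/eqP; have := F0 d; rewrite negbK.
pose Fd := pihomog mdeg d F.
exists (((Fd.@[e])^-1)%:MP * Fd); first exact/cone_idealM/cone_ideal_pihomog.
rewrite muniM muniC mul_polyC.
have coefd : (muni Fd)`_d = (Fd.@[e])%:MP by rewrite coef_muni_pihomog // eqxx.
have sz : size (muni Fd) = d.+1.
  apply/eqP; rewrite eqn_leq; apply/andP; split.
    apply/leq_sizeP => j lt_dj.
    by rewrite coef_muni_pihomog 1?ltnW // gtn_eqF.
  rewrite ltnNge; apply/negP => /leq_sizeP/(_ _ (leqnn _))/eqP.
  by rewrite coefd mpolyC_eq0 (negPf nzFd).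
by rewrite monicE lead_coefZ lead_coefE sz coefd -mpolyCM mulVf.
Qed.

(** [ev] restricts to the line of points whose first [n] coordinates are [c]. The restrictions form
    an ideal of a univariate polynomial ring without common root; Euclidean division lowers the
    degree of a member until it is constant. *)
Lemma cone_ideal_section n (y : nat -> E) (c : nat -> C)
    (ev := fun F : {mpoly C[n.+1]} =>
       map_poly (mmap idfun (fun j : 'I_n => c j)) (muni F)) F :
  (forall t, exists2 G : {mpoly C[n.+1]}, cone_ideal y G & (ev G).[t] != 0) ->
  cone_ideal y F -> ev F != 0 ->
  exists2 G : {mpoly C[n.+1]}, cone_ideal y G & ev G = 1.
Proof.
have evB G1 G2 : ev (G1 - G2) = ev G1 - ev G2 by rewrite /ev !rmorphB.
have evM G1 G2 : ev (G1 * G2) = ev G1 * ev G2 by rewrite /ev !rmorphM.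
have evC a : ev a%:MP = a%:P.
  by rewrite /ev muniC map_polyC /= mmapC.
have ev_surj h : exists G, ev G = h.
  elim/poly_ind: h => [|h a [G evG]]; first by exists 0%:MP; rewrite evC.
  exists (G * 'X_ord_max - (- a)%:MP); rewrite evB evM evC evG polyCN opprK.
  rewrite /ev muniE msuppX big_seq1 mcoeffX eqxx scale1r map_polyZ /= mmapX mnm1E eqxx.
  rewrite map_polyX -mul_polyC /mmap1 big1 ?mul1r // => j _.
  by rewrite mnmE mnm1E -val_eqE /= gtn_eqF // expr0.
move=> noroot; have [s] := ubnP (size (ev F)).
elim: s F => // s IH F lt_s yF nzF.
have [/size_poly1P[a nza evF]|/closed_rootP[t rt]] := boolP (size (ev F) == 1%N).
  exists ((a^-1)%:MP * F); first exact: cone_idealM.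
  by rewrite evM evC evF -polyCM mulVf.
have [G yG nzG] := noroot t.
(* Lifting the quotient to several variables makes the remainder again the restriction of a member
   of the ideal. It is nonzero because [ev F] vanishes at [t] and [ev G] does not. *)
have [h evh] := ev_surj (ev G %/ ev F).
have evR : ev (G - h * F) = ev G %% ev F.
  by rewrite evB evM evh {1}(divp_eq (ev G) (ev F)) addrC addKr.
apply: (IH (G - h * F)); last 2 first.
- exact/cone_idealB/cone_idealM.
- rewrite evR; apply: contraNneq nzG => r0.
  by rewrite (divp_eq (ev G) (ev F)) r0 addr0 hornerM (rootP rt) mulr0.
by rewrite evR -ltnS (leq_trans _ lt_s) // ltnS ltn_modp.
Qed.

(* A polynomial of the ideal not vanishing at the last basis vector makes [y n]
   algebraic over the previous coordinates; the norm from the corresponding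
   extension carries the separation hypothesis to one variable fewer. *)
Lemma derivation_cone (D : E -> E) n r (y : nat -> E) :
  {morph D : u v / u + v} -> (forall u v, D (u * v) = D u * v + u * D v) ->
  (forall a, D (i a) = 0) ->
  (r <= n)%N -> (forall j, (j < r)%N -> D (y j) = 0) ->
  (forall c : nat -> C, (forall j, (j < r)%N -> c j = 0) ->
     (exists2 j, (j < n)%N & c j != 0) ->
     exists2 F : {mpoly C[n]}, cone_ideal y F & F.@[fun j => c j] != 0) ->
  forall j, (j < n)%N -> D (y j) = 0.
Proof.
move=> DD DM Di; elim: n => // n IH le_rn Dy sep.
case: (ltngtP r n.+1) le_rn => // [lt_rn _|eq_rn _]; last by rewrite -eq_rn.
have [F yF nzF] : exists2 F : {mpoly C[n.+1]}, cone_ideal y F &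
    F.@[fun j => (j == ord_max)%:R] != 0.
  have [||F yF nzF] := sep (fun j => (j == n)%:R).
  - by move=> j lt_jr; rewrite ltn_eqF // (leq_trans lt_jr).
  - by exists n; rewrite ?eqxx ?oner_neq0.
  by exists F.
have [G yG monG] := cone_ideal_monic yF nzF.
have Dyn : forall j, (j < n)%N -> D (y j) = 0.
  apply: IH => // c c0 nzc.
  (* Every point of the line above [c] is nonzero with its first [r] coordinates 0, so [sep]
     excludes a common root. *)
  have [|||F1 yF1 evF1] := @cone_ideal_section n y c G.
  - move=> t; pose ct j := if j == n then t else c j.
    have [||F2 yF2 nzF2] := sep ct.
    + by move=> j lt_jr; rewrite /ct ltn_eqF ?c0 // (leq_trans lt_jr).
    + have [j lt_jn nzj] := nzc; exists j; first exact: ltnW.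
      by rewrite /ct ltn_eqF.
    exists F2 => //; move: nzF2; rewrite [meval _ _]horner_muni /ct eqxx.
    rewrite (_ : map_poly _ _ = map_poly (mmap idfun (fun j : 'I_n => c j)) (muni F2)) //.
    apply: eq_map_poly => p; apply: eq_bigr => m _; congr (_ * _).
    by apply: mmap1_eq => j; rewrite ltn_eqF.
  - exact: yG.
  - by apply: monic_neq0; apply: monic_map.
  (* The norm is 1 at [c], where [F1] restricts to 1, and 0 at multiples of [y], where [F1] and [G]
     vanish together. *)
  have [R [R0 R1]] := elimination_norm (muni F1) monG.
  exists R; last by rewrite [meval _ _]R1 ?oner_neq0.
  move=> a; apply: (R0 _ (mmap i (fun j : 'I_n => i a * y j)) (i a * y n));
    apply/rootP; rewrite -(@horner_muni _ _ i n (fun j => i a * y j)) //.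
move=> j; rewrite ltnS leq_eqVlt => /orP[/eqP ->|]; last exact: Dyn.
(* The cone condition on [G] at scale 1 is a monic equation for [y n] whose coefficients are killed
   by [D]. *)
have y1 l : y l = i 1 * y l by rewrite rmorph1 mul1r.
rewrite y1; pose f := map_poly (mmap i (fun j : 'I_n => i 1 * y j)) (muni G).
apply: (derivation_algebraic DD DM (f := f)).
- by move=> l; rewrite -(rmorph_nat i) fmorph_eq0.
- move=> l; rewrite coef_map; apply: derivation_mmap => // l'.
  by rewrite -y1 Dyn.
- by apply: monic_neq0; apply: monic_map.
- by rewrite -(@horner_muni _ _ i n (fun j => i 1 * y j)).
Qed.

End Cone.

(** * Linear algebra over domains and their fraction fields *)

Local Notation tofrac := (@FracField.tofrac _).

Lemma map_tofrac_inj (E : idomainType) m n :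
  injective (fun A : 'M[E]_(m, n) => map_mx tofrac A).
Proof.
move=> A B /matrixP eqAB; apply/matrixP => i j; apply/eqP.
by rewrite -tofrac_eq; have := eqAB i j; rewrite !mxE => ->.
Qed.

Lemma tofrac_numden (E : idomainType) (x : {fraction E}) :
  exists u : E * E, u.1 != 0 /\ tofrac u.2 = tofrac u.1 * x.
Proof.
elim/quotW: x => r; exists (\d_r, \n_r); split; first exact: denom_ratioP.
unlock FracField.tofrac; rewrite -[RHS]FracField.pi_mul; apply/eqmodP => /=.
rewrite FracField.equivfE /FracField.mulf /=.
rewrite !numden_Ratio ?mulf_neq0 ?oner_eq0 ?denom_ratioP //.
by rewrite !mul1r mulrC.
Qed.

Lemma clear_denominators (E : idomainType) m n (A : 'M[{fraction E}]_(m, n)) :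
  exists2 d : E, d != 0 &
    exists B : 'M[E]_(m, n), map_mx tofrac B = tofrac d *: A.
Proof.
have [u uP] := fin_all_exists (fun ij : 'I_m * 'I_n => tofrac_numden (A ij.1 ij.2)).
exists (\prod_ij (u ij).1); first by apply/prodf_neq0 => ij _; case: (uP ij).
exists (\matrix_(i, j) ((u (i, j)).2 * \prod_(ij | ij != (i, j)) (u ij).1)).
apply/matrixP => i j; rewrite !mxE rmorphM /=; case: (uP (i, j)) => _ ->.
by rewrite [in RHS](bigD1 (i, j)) //= rmorphM mulrAC.
Qed.

Lemma det_mul_thin (E : idomainType) s p (A : 'M[E]_(s, p)) (B : 'M[E]_(p, s)) :
  (p < s)%N -> \det (A *m B) = 0.
Proof.
move=> lt_ps; apply/eqP; rewrite -tofrac_eq0 -det_map_mx map_mxM.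
apply: contraTT lt_ps; rewrite -unitfE -unitmxE -row_free_unit -leqNgt.
by move=> /eqP <-; rewrite (leq_trans (mxrankM_maxl _ _)) ?rank_leq_col.
Qed.

Lemma nonzero_minor (F : fieldType) m n (A : 'M[F]_(m, n)) :
  exists f, exists g : 'I_(\rank A) -> _, \det (mxsub f g A) != 0.
Proof.
have full : row_full (rowsub (maxrankfun A) A)^T.
  by rewrite /row_full mxrank_tr; exact: maxrowsub_free.
exists (maxrankfun A), (fullrankfun full).
have := fullrowsub_unit full; rewrite unitmxE unitfE -det_tr.
by congr (\det _ != 0); apply/matrixP => i j; rewrite !mxE.
Qed.

(** [U] may have infinite dimension, so the kernel is reached by adding to [G] one kernel vector at
    a time, the rank being bounded by [N]; [L] is the cokernel matrix of the result. *)
Lemma linear_kernel_mx (F : fieldType) N (U : lmodType F) (f : {linear 'rV[F]_N -> U}) :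
  exists L : 'M[F]_N, forall v, v *m L = 0 <-> f v = 0.
Proof.
suff [G fG] : exists G : 'M[F]_N, forall v : 'rV_N, (v <= G)%MS <-> f v = 0.
  by exists (cokermx G) => v; rewrite -fG submxE; split=> [->|/eqP].
have sub0 : forall v : 'rV[F]_N, (v <= (0 : 'M_N))%MS -> f v = 0.
  by move=> v /submx0null ->; rewrite linear0.
have [d] := ubnP (N - \rank (0 : 'M[F]_N)).
elim: d (0 : 'M[F]_N) sub0 => // d IH G fG lt_d.
have [[v [fv nvG]]|maxG] := classic (exists v, f v = 0 /\ ~~ (v <= G)%MS); last first.
  exists G => v; split=> [|fv]; first exact: fG.
  by apply: contraT => nvG; case: maxG; exists v.
apply: (IH (G + v)%MS) => [w /sub_addsmxP[[a b] /= ->]|].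
  rewrite linearD fG ?submxMl // add0r.
  by rewrite [b]mx11_scalar mul_scalar_mx linearZ /= fv scaler0.
have ltr : (\rank G < \rank (G + v)%MS)%N.
  by apply: rank_ltmx; rewrite ltmxE addsmxSl addsmx_sub submx_refl /=.
have leN := rank_leq_col (G + v)%MS.
by rewrite -ltnS (leq_trans _ lt_d) // ltnS ltn_sub2l // (leq_trans ltr).
Qed.

(** The hypothesis passes to the fraction field by clearing denominators of [v]. There [T] factors
    through [T *m L], and [d] clears the denominators of the factor. *)
Lemma factor_through (E : idomainType) m n p (T : 'M[E]_(m, n)) (L : 'M[E]_(n, p)) :
  (forall v : 'rV[E]_m, v *m T *m L = 0 -> v *m T = 0) ->
  exists2 d : E, d != 0 & exists Q, d *: T = T *m L *m Q.
Proof.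
move=> kerT.
have kerTF k (V : 'M_(k, m)) :
    V *m map_mx tofrac (T *m L) = 0 -> V *m map_mx tofrac T = 0.
  move=> VTL; apply/row_matrixP => l; rewrite row0 row_mul.
  have [d nzd [v0 v0E]] := clear_denominators (row l V).
  have /kerT : v0 *m T *m L = 0.
    apply: map_tofrac_inj.
    by rewrite -mulmxA map_mxM v0E -scalemxAl -row_mul VTL row0 scaler0 map_mx0.
  move=> /(congr1 (map_mx tofrac)); rewrite map_mxM v0E -scalemxAl map_mx0.
  by move=> /eqP; rewrite scaler_eq0 tofrac_eq0 (negPf nzd) => /eqP.
have /submxP[Q0 TQ] : ((map_mx tofrac T)^T <= (map_mx tofrac (T *m L))^T)%MS.
  rewrite submxE; apply/eqP/trmx_inj; rewrite trmx0 trmx_mul trmxK.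
  by apply: kerTF; apply: trmx_inj; rewrite trmx_mul trmxK mulmx_coker trmx0.
have [d nzd [Q QE]] := clear_denominators Q0^T.
exists d => //; exists Q.
apply: map_tofrac_inj.
rewrite map_mxZ [in RHS]map_mxM QE -scalemxAr; congr (_ *: _).
by apply: trmx_inj; rewrite trmx_mul trmxK.
Qed.

(** * Linear projections of a cone *)

Definition row_nat (R : nzRingType) n (w : 'rV[R]_n) (j : nat) : R :=
  if insub j is Some o then w 0 o else 0.

Lemma row_natE (R : nzRingType) n (w : 'rV[R]_n) (j : 'I_n) : row_nat w j = w 0 j.
Proof. by rewrite /row_nat valK. Qed.

Lemma mmap_reindex (C E : comNzRingType) (i : {rmorphism C -> E}) n p
    (s : 'I_n -> 'I_p) (h : 'I_p -> E) (F : {mpoly C[n]}) :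
  mmap i h (mmap (@mpolyC p C) (fun j => 'X_(s j)) F) = mmap i (h \o s) F.
Proof.
rewrite [X in mmap i h X]/mmap rmorph_sum; apply: eq_bigr => m _.
rewrite rmorphM /= mmapC rmorph_prod; congr (_ * _); apply: eq_bigr => j _.
by rewrite rmorphXn /= mmapX mmap1U.
Qed.

Lemma mmap_eq (C E : comNzRingType) (i : {rmorphism C -> E}) n
    (h h' : 'I_n -> E) (F : {mpoly C[n]}) : h =1 h' -> mmap i h F = mmap i h' F.
Proof. by move=> hh; apply: eq_bigr => m _; rewrite (mmap1_eq _ hh). Qed.

(* Adjoining the coordinates of the projection [a *m L] to those of [a] turns
   the projection into a coordinate one. *)
Lemma derivation_projection (C : closedFieldType) (E : idomainType)
    (i : {rmorphism C -> E}) (D : E -> E) N r (L : 'M[C]_(N, r)) (a : 'rV[E]_N) :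
  (forall n, n.+1%:R != 0 :> C) ->
  {morph D : u v / u + v} -> (forall u v, D (u * v) = D u * v + u * D v) ->
  (forall c, D (i c) = 0) ->
  map_mx D (a *m map_mx i L) = 0 ->
  (forall c : 'rV[C]_N, c *m L = 0 -> c != 0 ->
     exists2 F : {mpoly C[N]},
       forall t, mmap i (fun j => i t * a 0 j) F = 0 & F.@[c 0] != 0) ->
  map_mx D a = 0.
Proof.
move=> char0 DD DM Di DaL sep; pose y := row_nat (row_mx (a *m map_mx i L) a).
have yl (s : 'I_r) : y s = (a *m map_mx i L) 0 s.
  by rewrite /y -[s : nat]/(lshift N s : nat) row_natE row_mxEl.
have yr (j : 'I_N) : y (r + j)%N = a 0 j.
  by rewrite /y -[(r + j)%N]/(rshift r j : nat) row_natE row_mxEr.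
apply/rowP => j; rewrite !mxE -yr.
apply: (derivation_cone char0 DD DM Di (leq_addr N r)) => [s lt_sr|c c0 nzc|].
- have := congr1 (fun w : 'rV_r => w 0 (Ordinal lt_sr)) DaL.
  by rewrite [LHS]mxE [RHS]mxE -yl.
- pose c2 : 'rV[C]_N := \row_j c (r + j)%N.
  have nzc2 : c2 != 0.
    have [l lt_l nzl] := nzc; apply: contraNneq nzl => c20.
    case: (ltnP l r) => [/c0 -> //|le_rl].
    have lt_lr : (l - r < N)%N by rewrite ltn_subLR.
    have := congr1 (fun w : 'rV_N => w 0 (Ordinal lt_lr)) c20.
    by rewrite !mxE /= subnKC // => ->.
  (* A point [c] with first [r] coordinates 0 is separated by a polynomial in the last [N]
     coordinates if [c2] is in the kernel of [L], and otherwise by one of the linear equations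
     defining the projection. *)
  have [c2L|/eqP/rowP nzL] := eqVneq (c2 *m L) 0.
    have [F aF nzF] := sep c2 c2L nzc2.
    exists (mmap (@mpolyC _ C) (fun j => 'X_(rshift r j)) F).
      move=> t; rewrite mmap_reindex -(aF t); apply: mmap_eq => l /=.
      by rewrite yr.
    apply: contraNneq nzF; rewrite [meval _ _](mmap_reindex idfun) => <-.
    by apply/eqP/mmap_eq => l /=; rewrite mxE.
  have [s nzs] : exists s, (c2 *m L) 0 s != 0.
    apply/existsP; rewrite -negb_forall; apply/negP => /forallP z.
    by apply: nzL => s; rewrite (eqP (z s)) mxE.
  pose F : {mpoly C[r + N]} := 'X_(lshift N s) - \sum_l L l s *: 'X_(rshift r l).
  have mmapF (B : comNzRingType) (phi : {rmorphism C -> B}) h : mmap phi h F =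
      h (lshift N s) - \sum_l phi (L l s) * h (rshift r l).
    rewrite rmorphB rmorph_sum /= mmapX mmap1U; congr (_ - _).
    by apply: eq_bigr => l _; rewrite mmapZ mmapX mmap1U.
  exists F => [t|].
    rewrite mmapF /= yl mxE mulr_sumr -sumrB big1 // => l _.
    by rewrite yr mxE; ring.
  apply: contraNneq nzs; rewrite [meval _ _]mmapF /= c0 // sub0r => /eqP.
  rewrite oppr_eq0 => /eqP <-; rewrite mxE; apply/eqP.
  by apply: eq_bigr => l _; rewrite mxE mulrC.
- by rewrite ltn_add2l.
Qed.

(** * Polynomial vector fields *)

Section VectorField.
Variables (C : comNzRingType) (n : nat) (v : 'rV[{mpoly C[n]}]_n).

(** Every direction at the generic matrix comes from such a derivation. *)
Definition mfield (p : {mpoly C[n]}) := \sum_j v 0 j * p^`M(j).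

Lemma mfieldD : {morph mfield : p q / p + q}.
Proof.
move=> p q; rewrite -big_split; apply: eq_bigr => j _.
by rewrite mderivD mulrDr.
Qed.

Lemma mfieldM p q : mfield (p * q) = mfield p * q + p * mfield q.
Proof.
rewrite mulr_suml mulr_sumr -big_split; apply: eq_bigr => j _ /=.
by rewrite mderivM; ring.
Qed.

Lemma mfieldC c : mfield c%:MP = 0.
Proof. by apply: big1 => j _; rewrite mderivC mulr0. Qed.

Lemma mfieldX j : mfield 'X_j = v 0 j.
Proof.
rewrite /mfield (bigD1 j) //= big1 => [|l ne_lj].
  rewrite mderivX mnm1E eqxx scale1r addr0.
  by rewrite (_ : (U_(j) - U_(j) = 0)%MM) ?mpolyX0 ?mulr1 //;
    apply/mnmP => l; rewrite mnmBE mnm0E subnn.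
by rewrite mderivX mnm1E eq_sym (negPf ne_lj) scale0r mulr0.
Qed.

End VectorField.

(** * Forms of bounded rank and their parametrization *)

Lemma symplectic_mx (C : comUnitRingType) k :
  exists J : 'M[C]_(k.*2), J^T = - J /\ J \in unitmx.
Proof.
rewrite -addnn; pose J : 'M[C]_(k + k) := block_mx 0 1%:M (- 1%:M) 0.
exists J; split.
  by rewrite tr_block_mx opp_block_mx !trmx0 !raddfN /= trmx1 opprK !oppr0.
suff /mulmx1_unit[] : J *m - J = 1%:M by [].
rewrite mulmxN mulmx_block !(mul0mx, mulmx0, mul1mx, mulmx1, add0r, addr0).
by rewrite opp_block_mx !oppr0 opprK -scalar_mx_block.
Qed.

(* The differential at [X] of the parametrization [X |-> X^T *m J *m X] of the
   forms of rank at most [p]; for invertible [J] its image is [W /\ V], with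
   [W] the row space of [X]. *)
Definition dform (R : comNzRingType) p q (J : 'M[R]_p) (X N : 'M[R]_(p, q)) : 'M[R]_q :=
  N^T *m J *m X + X^T *m J *m N.

Lemma dform_is_linear (R : comNzRingType) p q (J : 'M[R]_p) (X : 'M[R]_(p, q)) :
  linear (dform J X).
Proof.
move=> a N N'; rewrite /dform linearP /= !mulmxDl mulmxDr -!scalemxAl -scalemxAr.
by rewrite scalerDr addrACA.
Qed.

HB.instance Definition _ (R : comNzRingType) p q (J : 'M[R]_p) (X : 'M[R]_(p, q)) :=
  GRing.isLinear.Build R 'M[R]_(p, q) 'M[R]_q _ (dform J X) (dform_is_linear J X).

Lemma map_dform (R S : comNzRingType) (phi : {rmorphism R -> S}) p q
    (J : 'M[R]_p) (X N : 'M[R]_(p, q)) :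
  map_mx phi (dform J X N) = dform (map_mx phi J) (map_mx phi X) (map_mx phi N).
Proof. by rewrite /dform map_mxD !map_mxM !map_trmx. Qed.

Definition generic_mx (C : comNzRingType) p q : 'M[{mpoly C[p * q]}]_(p, q) :=
  vec_mx (\row_j 'X_j).

Lemma mmap_generic_mx (C S : comNzRingType) (i : {rmorphism C -> S}) p q
    (w : 'rV[S]_(p * q)) :
  map_mx (mmap i (w 0)) (generic_mx C p q) = vec_mx w.
Proof.
by rewrite map_vec_mx; congr vec_mx; apply/rowP => j; rewrite !mxE /= mmapX mmap1U.
Qed.

Lemma mx_eval_generic (C : comNzRingType) p q (M : 'M[C]_(p, q)) :
  map_mx (fun P => mx_eval P M) (generic_mx C p q) = M.
Proof. by rewrite -[RHS]mxvecK -(mmap_generic_mx idfun). Qed.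

(** * The generic form of rank at most [p] *)

Section GenericForm.
Variables (C : closedFieldType) (p q : nat) (J : 'M[C]_p) (r : nat).
Variable L : 'M[C]_(q * q, r).
Hypothesis char0 : forall n, n.+1%:R != 0 :> C.
Hypothesis antiJ : J^T = - J.
Hypothesis rankL : forall A : 'M[C]_q,
  A^T = - A -> A != 0 -> mxvec A *m L = 0 -> (p < \rank A)%N.

Let E := {mpoly C[p * q]}.
Let X := generic_mx C p q.
Let i := @mpolyC (p * q) C.

(** If [c] is not antisymmetric, an entry of [Y + Y^T] separates it. Otherwise its rank exceeds [p],
    and a nonzero minor of that size vanishes on every multiple of the generic form, which factors
    through [p] dimensions. *)
Lemma generic_form_separated (c : 'rV[C]_(q * q)) : c *m L = 0 -> c != 0 ->
  exists2 F : {mpoly C[q * q]},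
    forall t, mmap i (fun j => i t * mxvec (X^T *m map_mx i J *m X) 0 j) F = 0 &
    F.@[c 0] != 0.
Proof.
move=> cL nzc; set a := X^T *m _ *m X; pose Y := generic_mx C q q.
have evY (t : C) : map_mx (mmap i (fun j => i t * mxvec a 0 j)) Y = i t *: a.
  rewrite -[RHS]mxvecK -(mmap_generic_mx i); apply/matrixP => u v; rewrite !mxE.
  by apply: mmap_eq => j; rewrite linearZ /= mxE.
have evc : map_mx (meval (c 0)) Y = vec_mx c by rewrite -(mmap_generic_mx idfun).
have antia : a^T = - a.
  by rewrite /a !trmx_mul trmxK map_trmx antiJ map_mxN mulNmx mulmxN mulmxA.
have nzc' : vec_mx c != 0 :> 'M_q.
  by apply: contraNneq nzc => c0; rewrite -[c]vec_mxK c0 linear0.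
have [antic|/eqP nantic] := eqVneq (vec_mx c)^T (- vec_mx c :> 'M_q); last first.
  have [[u v] nzuv] : exists uv, (vec_mx c + (vec_mx c)^T : 'M_q) uv.1 uv.2 != 0.
    apply/existsP; rewrite -negb_forall; apply/negP => /forallP z; apply: nantic.
    apply/eqP; rewrite -addr_eq0 addrC; apply/eqP/matrixP => u v.
    by rewrite (eqP (z (u, v))) mxE.
  exists ((Y + Y^T) u v) => [t|].
    have -> (F : 'M[{mpoly C[q * q]}]_q) : mmap i (fun j => i t * mxvec a 0 j) (F u v) =
        map_mx (mmap i (fun j => i t * mxvec a 0 j)) F u v by rewrite mxE.
    by rewrite map_mxD -map_trmx evY linearZ /= antia scalerN subrr mxE.
  have -> (F : 'M[{mpoly C[q * q]}]_q) :
      meval (c 0) (F u v) = map_mx (meval (c 0)) F u v by rewrite mxE.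
  by rewrite map_mxD -map_trmx evc.
have := rankL antic nzc'; rewrite vec_mxK => /(_ cL) lt_pr.
have [f [g nzfg]] := nonzero_minor (vec_mx c : 'M_q).
exists (\det (mxsub f g Y)) => [t|]; last by rewrite -det_map_mx map_mxsub evc.
rewrite -det_map_mx map_mxsub evY /a scalemxAl mxsub_mul.
exact: det_mul_thin.
Qed.

(** The derivation along [v] maps [X] to [N] and the generic form to [dform] at [N]; if it kills the
    projection of the form, it kills the form. *)
Lemma dform_generic_ker (v : 'rV[E]_(p * q)) :
  let T := lin_mx (dform (map_mx i J) X) in
  v *m T *m map_mx i L = 0 -> v *m T = 0.
Proof.
rewrite -[v]vec_mxK; set N := vec_mx v => /=; rewrite mul_vec_lin /=.
set D := mfield v; have DX : map_mx D X = N.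
  by apply/matrixP => u w; rewrite !mxE /D mfieldX.
have DC m n (A : 'M[C]_(m, n)) : map_mx D (map_mx i A) = 0.
  by apply/matrixP => u w; rewrite !mxE /D mfieldC.
have DMx m n s := @map_derivationM _ D (mfieldD v) (mfieldM v) m n s.
have Da : map_mx D (mxvec (X^T *m map_mx i J *m X)) = mxvec (dform (map_mx i J) X N).
  by rewrite map_mxvec !DMx DC mulmx0 addr0 -map_trmx DX.
rewrite -Da => DaL.
apply: (@derivation_projection C E i D _ _ L) => //.
- exact: mfieldD.
- exact: mfieldM.
- exact: mfieldC.
- by rewrite DMx DC mulmx0 addr0.
- exact: generic_form_separated.
Qed.

End GenericForm.

(** * Specialization of the generic identity *)

Theorem theorem4p1 (C : numClosedFieldType) (q : nat) (U : lmodType C)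
  (psi2 : {linear 'M[C]_q -> U}) (k : nat) :
  (0 < q)%N -> (0 < k)%N -> (k.*2 <= q)%N ->
  (forall A : 'M[C]_q, antisym A -> A != 0 -> psi2 A = 0 ->
     (k.*2 < \rank A)%N) ->
  exists P : {mpoly C[k.*2 * q]}, P != 0 /\
    forall M : 'M[C]_(k.*2, q), mx_eval P M != 0 ->
      \rank M = k.*2 /\ complex_exact psi2 M.
Proof.
move=> _ _ le_kq rank_ker.
have char0 n : n.+1%:R != 0 :> C by rewrite pnatr_eq0.
have [J [antiJ unitJ]] := symplectic_mx C k.
have [L LP] := linear_kernel_mx (psi2 \o vec_mx).
have rankL (A : 'M[C]_q) : A^T = - A -> A != 0 -> mxvec A *m L = 0 -> (k.*2 < \rank A)%N.
  by move=> antiA nzA /LP; rewrite /= mxvecK; apply: rank_ker.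
have [d nzd [Q dTE]] := factor_through (dform_generic_ker char0 antiJ rankL).
pose X := generic_mx C k.*2 q; pose g := widen_ord le_kq.
pose minor := \det (colsub g X).
have ev_minor M : mx_eval minor M = \det (colsub g M).
  rewrite /mx_eval /minor -(det_map_mx (meval _)) map_mxsub.
  by congr (\det (colsub g _)); exact: mx_eval_generic.
(* Where [d] is nonzero the identity [dTE] can be specialized; where the minor on the first [k.*2]
   columns is nonzero, [M] has full rank. *)
exists (d * minor); split.
  rewrite mulf_neq0 //; apply/eqP => minor0.
  have := ev_minor (\matrix_(u, v) (v == g u)%:R); rewrite minor0 /mx_eval meval0.
  rewrite (_ : colsub _ _ = 1%:M) ?det1 => [/eqP|]; first by rewrite eq_sym oner_eq0.
  by apply/matrixP => u v; rewrite !mxE -val_eqE /= eq_sym.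
move=> M; rewrite /mx_eval mevalM mulf_eq0 negb_or => /andP[nzdM].
rewrite -/(mx_eval _ _) ev_minor => nz_minor; split.
  apply/eqP; rewrite eqn_leq rank_leq_row /=.
  have : colsub g M \in unitmx by rewrite unitmxE unitfE.
  rewrite -row_free_unit => /eqP {1}<-.
  by rewrite -[M in colsub _ M]mulmx1 -mulmx_colsub mxrankM_maxl.
split=> [S _ /eqP|Y /submxP[Z YZ]].
  by rewrite /mu0 -scaler_nat scaler_eq0 pnatr_eq0 => /eqP.
split=> [|[S [symS _] ->]]; last first.
  by rewrite /mu1 /mu0 raddfMn /= symS subrr linear0.
rewrite /mu1 => psiY.
(* With [Y^T = Z *m M], the direction [invmx J *m Z^T] yields [Y] from one summand of [dform] and,
   by antisymmetry of [J], [- Y^T] from the other. *)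
have YE : Y - Y^T = dform J M (invmx J *m Z^T).
  have KJ : (invmx J)^T *m J = - 1%:M.
    by rewrite -[J in _ *m J]opprK -antiJ mulmxN -trmx_mul mulmxV // trmx1.
  rewrite /dform trmx_mul trmxK -[Y in Y - _]trmxK YZ trmx_mul.
  rewrite -(mulmxA M^T) mulKVmx // addrC; congr (_ + _).
  by rewrite -(mulmxA Z) KJ mulmxN mulmx1 mulNmx.
have symY : Y - Y^T = 0.
  pose e := meval (fun j => mxvec M 0 j).
  have evX : map_mx e X = M by rewrite -[RHS]mx_eval_generic.
  have evC m n (A : 'M[C]_(m, n)) : map_mx e (map_mx (@mpolyC _ _) A) = A.
    by apply/matrixP => u v; rewrite !mxE /e mevalC.
  have evT : map_mx e (lin_mx (dform (map_mx (@mpolyC _ _) J) X)) = lin_mx (dform J M).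
    by apply: map_lin_mx => N; rewrite map_dform evC evX.
  (* At [M] the identity writes a nonzero multiple of [Y - Y^T] as the image under [Q] of its
     projection by [L], which is 0 by [psiY]. *)
  have := congr1 (map_mx e) dTE.
  rewrite map_mxZ 2!map_mxM evC evT.
  move=> /(congr1 (mulmx (mxvec (invmx J *m Z^T)))).
  rewrite -scalemxAr 2!mulmxA mul_vec_lin /= -YE.
  have /LP -> : (psi2 \o vec_mx) (mxvec (Y - Y^T)) = 0 by rewrite /= mxvecK.
  move=> /eqP; rewrite mul0mx scaler_eq0 (negPf nzdM) /= => /eqP vY0.
  by rewrite -[LHS]mxvecK vY0 linear0.
move/eqP: symY; rewrite subr_eq0 => /eqP symY.
exists (2%:R^-1 *: Y).
  split; first by rewrite linearZ /= -symY.
  by rewrite scalemx_sub // symY YZ submxMl.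
by rewrite /mu0 -scaler_nat scalerA mulfV ?pnatr_eq0 // scale1r.
Qed.
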